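(* Let $\Delta$ and $\Delta'$ be simplicial complexes on $[d]=\{1,\ldots,d\}$ and let $\mathcal{P}\subset\mathbb{R}^d$ be the convex hull of $\mathcal{P}_\Delta\cup(-\mathcal{P}_{\Delta'})$. Then $\mathcal{P}$ is a Gorenstein Fano polytope if and only if there exist perfect graphs $G$ and $G'$ on $[d]$ with $\Delta=S(G)$ and $\Delta'=S(G')$.
   Context: A simplicial complex $\Delta$ on $[d]$ is a collection of subsets of $[d]$ with $\{i\}\in\Delta$ for every $i\in[d]$, such that $F\in\Delta$ and $F'\subset F$ imply $F'\in\Delta$ (so $\emptyset\in\Delta$). For $W\subset[d]$ put $\rho(W)=\sum_{j\in W}\mathbf{e}_j\in\mathbb{R}^d$, where $\mathbf{e}_j$ are the standard unit vectors. $\mathcal{P}_\Delta\subset\mathbb{R}^d$ is the convex hull of $\{\rho(F):F\in\Delta\}$, and $-\mathcal{P}_{\Delta'}=\{-v: v\in\mathcal{P}_{\Delta'}\}$. An integral convex polytope is a convex polytope all of whose vertices have integer coordinates. An integral convex polytope $\mathcal{P}\subset\mathbb{R}^d$ of dimension $d$ is a Fano polytope if the origin is the unique integer point in the interior of $\mathcal{P}$. A Fano polytope is Gorenstein (also called reflexive) if its dual polytope $\mathcal{P}^\vee$ is again integral; equivalently, each facet of $\mathcal{P}$ lies on a hyperplane of the form $a_1z_1+\cdots+a_dz_d=1$ with all $a_j\in\mathbb{Z}$. Graphs are finite and simple. A subset $W\subset[d]$ is stable in $G$ if no two distinct elements of $W$ form an edge of $G$; $S(G)$ denotes the set of all stable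 sets of $G$ (a simplicial complex on $[d]$). A graph $G$ is perfect if for every induced subgraph $H$ of $G$ (including $G$) the chromatic number of $H$ equals the maximal cardinality of cliques of $H$. *)

(* Defs.v *)
From HB Require Import structures.
From mathcomp Require Import all_boot all_order all_algebra.
From mathcomp Require Import all_classical all_reals all_analysis.

Set Implicit Arguments.
Unset Strict Implicit.
Unset Printing Implicit Defensive.

Import Order.TTheory GRing.Theory Num.Theory.
Import numFieldNormedType.Exports.

Local Open Scope classical_set_scope.
Local Open Scope ring_scope.

Record sgraph (V : finType) := SGraph {
  edge :> rel V;
  edge_sym : symmetric edge;
  edge_irrefl : irreflexive edge }.

Section Graph.
Context {V : finType}.
Implicit Types (G : sgraph V) (W : {set V}).

Definition stable G W : bool :=
  [forall x in W, forall y in W, (x != y) ==> ~~ G x y].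

Definition clique G W : bool :=
  [forall x in W, forall y in W, (x != y) ==> G x y].

Definition stable_sets G : {set {set V}} := [set W | stable G W]%SET.

Definition clique_number G : nat :=
  (\max_(W : {set V} | clique G W) #|W|)%N.

Definition colorable G (k : nat) : bool :=
  [exists c : {ffun V -> 'I_k}, [forall x, forall y, G x y ==> (c x != c y)]].

Lemma ex_colorable G : exists k, colorable G k.
Proof.
exists #|V|; apply/existsP; exists [ffun x => enum_rank x].
apply/forallP => x; apply/forallP => y; apply/implyP => Gxy.
rewrite !ffunE (inj_eq enum_rank_inj).
by apply: contraL Gxy => /eqP ->; rewrite edge_irrefl.
Qed.

Definition chromatic_number G : nat := ex_minn (ex_colorable G).

Section Induced.
Variables (G : sgraph V) (W : {set V}).

Definition induced_edge : rel {x : V | x \in W} :=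
  fun x y => G (val x) (val y).

Lemma induced_sym : symmetric induced_edge.
Proof. by move=> x y; exact: edge_sym. Qed.

Lemma induced_irrefl : irreflexive induced_edge.
Proof. by move=> x; exact: edge_irrefl. Qed.

Definition induced : sgraph {x : V | x \in W} :=
  SGraph induced_sym induced_irrefl.
End Induced.

End Graph.

Definition perfect (V : finType) (G : sgraph V) : Prop :=
  forall W : {set V},
    chromatic_number (induced G W) = clique_number (induced G W).

(* For d > 0 the condition on the empty set follows from the other two. *)
Definition simplicial_complex (d : nat) (D : {set {set 'I_d}}) : Prop :=
  [/\ finset.set0 \in D, forall i : 'I_d, [set i]%SET \in D
    & forall F F' : {set 'I_d}, F \in D -> F' \subset F -> F' \in D].

Section Polytope.
Context {R : realType} {d : nat}.
Implicit Types (A Q : set 'rV[R]_d) (v : 'rV[R]_d).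

Definition conv_hull A : set 'rV[R]_d := smallest (@convex_set R 'rV[R]_d) A.

Definition affine_hull A : set 'rV[R]_d :=
  [set x | exists (n : nat) (a : 'I_n -> R) (p : 'I_n -> 'rV[R]_d),
     [/\ forall i, A (p i), \sum_i a i = 1 & x = \sum_i a i *: p i]].

(* The affine hull of [A] is the translate by [x0] of the row space of [U]. *)
Definition has_dim A (k : nat) : Prop :=
  exists (x0 : 'rV[R]_d) (U : 'M[R]_d),
    \rank U = k /\ affine_hull A = [set x | (x - x0 <= U)%MS].

Definition dotv (u v : 'rV[R]_d) : R := \sum_i u 0 i * v 0 i.

Definition is_polytope Q : Prop :=
  exists s : seq 'rV[R]_d, Q = conv_hull [set` s].

(* Vertices are the faces consisting of a single point, where a face is the
   intersection of [Q] with [dotv a x = b] for a valid inequality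
   [dotv a x <= b]. *)
Definition is_vertex Q v : Prop :=
  exists (a : 'rV[R]_d) (b : R),
    (forall x, Q x -> dotv a x <= b) /\
    Q `&` [set x | dotv a x = b] = [set v].

Definition integer_point v : Prop := v \is a mxOver (@Num.int R).

Definition integral_polytope Q : Prop :=
  is_polytope Q /\ forall v, is_vertex Q v -> integer_point v.

Definition dual_polytope Q : set 'rV[R]_d :=
  [set y | forall x, Q x -> dotv x y <= 1].

Definition fano_polytope Q : Prop :=
  [/\ integral_polytope Q, has_dim Q d
    & interior Q `&` integer_point = [set 0]].

Definition gorenstein_fano_polytope Q : Prop :=
  fano_polytope Q /\ integral_polytope (dual_polytope Q).

Definition rho (W : {set 'I_d}) : 'rV[R]_d := \sum_(j in W) delta_mx 0 j.

Definition complex_polytope (D : {set {set 'I_d}}) : set 'rV[R]_d :=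
  conv_hull [set rho F | F in [set` D]].

End Polytope.

(* Main.v *)
Require Import Defs.
From mathcomp Require Import all_boot all_order all_algebra.
From mathcomp Require Import all_classical all_reals all_analysis.
From mathcomp Require Import ring lra.

(** Write [A = P_D], [B = P_D'], [P = conv(A, -B)], and for a family [D] closed
    under subsets let [D^*] be the set of [y >= 0] with [y(F) <= 1] for all [F]
    in [D], where [y(F)] is the sum of [y] over [F].  The polytope [P] is always
    a Fano polytope: its generators have coordinates in [{-1, 0, 1}], it
    contains all the unit vectors and their opposites, and its points have
    coordinates of absolute value at most 1.  So everything depends on the
    integrality of the dual, which consists of the [y] with [y(F) <= 1] on [D]
    and [-y(F) <= 1] on [D'].  Since [D] and [D'] are closed under subsets, [y]
    is in the dual iff its positive part is in [D^*] and its negative part in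
    [D'^*].

    If the dual is integral, the maximum of [y(W)] over it is reached at an
    integral vertex [v] ([polytope_max_vertex]).  Singletons are faces, so the
    coordinates of [v] are at most 1, and the set [C] of those [i] in [W] where
    [v_i = 1] meets every face in at most one point; hence [y(W) <= #|C|] for all
    [y] in [D^*] ([bound_of_integral_polytope]).  Let [G] have as edges the pairs
    that are not faces, so that such sets [C] are cliques.  If some stable [W]
    were not a face, the indicator of [W] divided by [#|W| - 1/2] would violate
    this bound, as a clique inside [W] has at most one point; thus [D = S(G)]
    ([stable_sets_of_bound]).  If no stable set met all the maximum cliques of
    the subgraph induced on [W], averaging one missed clique per stable set would
    violate it too; so removing suitable stable sets one by one colours [W] with
    as many colours as its largest clique has points, and [G] is perfect
    ([perfect_of_clique_bound]).

    Conversely, for [G] perfect every [y] in [S(G)^*] is a convex combination of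
    indicators of cliques ([clique_decomposition]).  This is the polyhedral form
    of the weak perfect graph theorem; it is obtained by peeling off cliques that
    meet every tight stable set.  Such a clique exists
    ([tight_hitting_clique]) because perfection survives the replication of
    vertices ([weighted_cover]).  Applied to the positive and the negative part
    of a point of the dual, this writes the dual as the convex hull of the
    differences of an indicator of a clique of [G] and an indicator of a clique
    of [G'], all of which are integral ([integral_dual_twinned]). *)

Set Implicit Arguments.
Unset Strict Implicit.
Unset Printing Implicit Defensive.

Import Order.TTheory GRing.Theory Num.Theory.

(** * Stable sets, cliques and colourings *)

Section StableCliques.
Context {V : finType} (G : sgraph V).
Implicit Types (W F K S : {set V}) (h : V -> nat).

Lemma stableP W :
  reflect (forall x y, x \in W -> y \in W -> ~~ G x y) (stable G W).
Proof.
apply: (iffP forall_inP) => [st x y xW yW|st x xW].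
  have [->|xy] := eqVneq x y; first by rewrite edge_irrefl.
  by have /forall_inP/(_ y yW)/implyP/(_ xy) := st x xW.
by apply/forall_inP => y yW; apply/implyP => _; exact: st.
Qed.

Lemma cliqueP W :
  reflect (forall x y, x \in W -> y \in W -> x != y -> G x y) (clique G W).
Proof.
apply: (iffP forall_inP) => [cl x y xW yW xy|cl x xW].
  by have /forall_inP/(_ y yW)/implyP/(_ xy) := cl x xW.
by apply/forall_inP => y yW; apply/implyP; exact: cl.
Qed.

Lemma stable_sub F F' : F' \subset F -> stable G F -> stable G F'.
Proof.
move=> /fintype.subsetP sub /stableP st; apply/stableP => x y /sub xF /sub yF.
exact: st.
Qed.

Lemma clique_sub K K' : K' \subset K -> clique G K -> clique G K'.
Proof.
move=> /fintype.subsetP sub /cliqueP cl; apply/cliqueP => x y /sub xK /sub yK.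
exact: cl.
Qed.

Lemma stable0 : stable G finset.set0.
Proof. by apply/stableP => x y; rewrite finset.inE. Qed.

Lemma clique0 : clique G finset.set0.
Proof. by apply/cliqueP => x y; rewrite finset.inE. Qed.

Lemma stable1 x : stable G [set x].
Proof. by apply/stableP => u v /set1P-> /set1P->; rewrite edge_irrefl. Qed.

Lemma clique1 x : clique G [set x].
Proof. by apply/cliqueP => u v /set1P-> /set1P->; rewrite eqxx. Qed.

Lemma card_clique_stable K F : clique G K -> stable G F -> #|K :&: F| <= 1.
Proof.
move=> /cliqueP cl /stableP st; apply/card_le1_eqP => x y.
rewrite !finset.inE => /andP[xK xF] /andP[yK yF].
apply/eqP; apply: contraT => xy; have := st _ _ xF yF.
by rewrite cl // eq_sym.
Qed.

End StableCliques.

Section Perfect.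
Context {V : finType} (G : sgraph V).
Implicit Types (W F K S : {set V}) (h : V -> nat).

(** Colourings are handled as coverings: [h x] is the number of sets required
    to contain [x], so that the indicator of [W] gives the colourings of the
    subgraph induced on [W], and general weights the colourings of the graphs
    obtained by replicating vertices. *)
Definition stable_cover h (n : nat) : Prop :=
  exists Fs : seq {set V},
    [/\ size Fs <= n, all (stable G) Fs
      & forall x, h x <= count (fun F : {set V} => x \in F) Fs].

Lemma sum_count_mem W (Fs : seq {set V}) :
  \sum_(x in W) count (fun F : {set V} => x \in F) Fs
  = \sum_(F <- Fs) #|W :&: F|.
Proof.
under eq_bigr do rewrite -sum1_count big_mkcond.
rewrite exchange_big /=; apply: eq_bigr => F _.
rewrite -sum1_card [RHS](eq_bigl (fun x => (x \in W) && (x \in F))).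
  by rewrite big_mkcondr.
by move=> x; rewrite finset.inE.
Qed.

(** The easy inequality between colourings and cliques, for weights: each stable
    set of the cover accounts for at most one point of the clique. *)
Lemma weight_clique_le h n K :
  stable_cover h n -> clique G K -> \sum_(x in K) h x <= n.
Proof.
move=> [Fs [sz /allP st cov]] cl; apply: leq_trans sz.
apply: (@leq_trans (\sum_(F <- Fs) #|K :&: F|)).
  by rewrite -sum_count_mem; apply: leq_sum => x _.
rewrite -sum1_size big_seq [leqRHS]big_seq; apply: leq_sum => F FFs.
by apply: (card_clique_stable cl); exact: st.
Qed.

Lemma colorable_inducedP W n :
  colorable (Defs.induced G W) n <-> stable_cover (fun x => x \in W) n.
Proof.
split=> [/existsP[c /forallP col]|[Fs [sz /allP st cov]]].
  exists [seq val @: [set u | c u == j] | j <- enum 'I_n]; split.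
  - by rewrite size_map size_enum_ord.
  - apply/allP => _ /mapP[j _ ->]; apply/stableP => x y.
    move=> /imsetP[u]; rewrite finset.inE => /eqP uj ->.
    move=> /imsetP[v]; rewrite finset.inE => /eqP vj ->.
    apply/negP => Guv; have /forallP/(_ v)/implyP := col u.
    by move=> /(_ Guv); rewrite uj vj eqxx.
  - move=> x; case: (boolP (x \in W)) => // xW; rewrite -has_count.
    apply/hasP; exists (val @: [set u | c u == c (exist _ x xW)]).
      by apply/mapP; exists (c (exist _ x xW)); rewrite // mem_enum.
    by apply/imsetP; exists (exist _ x xW); rewrite // finset.inE.
have ltn (u : {x | x \in W}) : find (fun F : {set V} => val u \in F) Fs < n.
  move: u => [x xW] /=; apply: leq_trans sz; rewrite -has_find has_count.
  by apply: leq_trans (cov x); rewrite xW.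
apply/existsP; exists [ffun u => Ordinal (ltn u)].
apply/forallP => u; apply/forallP => v; apply/implyP => Guv; rewrite !ffunE.
apply/negP => /eqP/(congr1 val) /= eq_uv.
have in_first (w : {x | x \in W}) :
    val w \in nth finset.set0 Fs (find (fun F : {set V} => val w \in F) Fs).
  apply: (nth_find finset.set0 (a := fun F : {set V} => val w \in F)).
  move: w => [x xW] /=; rewrite has_count; apply: leq_trans (cov x).
  by rewrite xW.
have Fst : stable G (nth finset.set0 Fs
                       (find (fun F : {set V} => val u \in F) Fs)).
  case: (ltnP (find (fun F : {set V} => val u \in F) Fs) (size Fs)) => lt.
    by apply: st; exact: mem_nth.
  by rewrite nth_default // stable0.
have := in_first v; rewrite -eq_uv => vF.
by have /stableP/(_ _ _ (in_first u) vF)/negP := Fst; apply.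
Qed.

Lemma clique_number_inducedP W n :
  clique_number (Defs.induced G W) <= n <->
  (forall K, clique G K -> K \subset W -> #|K| <= n).
Proof.
split=> [/bigmax_leqP le K /cliqueP cl /fintype.subsetP KW|le].
  have -> : K = val @: [set u : {x | x \in W} | val u \in K].
    apply/finset.setP => x; apply/idP/imsetP => [xK|[u]].
      by exists (exist _ x (KW x xK)); rewrite // finset.inE.
    by rewrite finset.inE => ? ->.
  rewrite card_imset; last exact: val_inj.
  apply: le; apply/cliqueP => u v; rewrite !finset.inE => uK vK uv.
  exact: cl.
apply/bigmax_leqP => K /cliqueP cl; rewrite -(card_imset _ val_inj).
apply: le; last by apply/fintype.subsetP => _ /imsetP[u _ ->]; exact: valP.
apply/cliqueP => _ _ /imsetP[u uK ->] /imsetP[v vK ->] uv.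
exact: (cl u v uK vK).
Qed.

(** Only the inequality of the chromatic number by the clique number has
    content, and it can be tested against any upper bound [n] of the clique
    number. *)
Lemma perfect_coverP :
  perfect G <->
  (forall W n, (forall K, clique G K -> K \subset W -> #|K| <= n) ->
     stable_cover (fun x => x \in W) n).
Proof.
split=> [perf W n /clique_number_inducedP|cover W].
  rewrite -perf /chromatic_number; case: ex_minnP => k /colorable_inducedP.
  move=> [Fs [sz st cov]] _ kn; exists Fs; split=> //; exact: leq_trans kn.
rewrite /chromatic_number; case: ex_minnP => k col kmin.
apply/eqP; rewrite eqn_leq; apply/andP; split.
  apply: kmin; apply/colorable_inducedP; apply: cover.
  exact/clique_number_inducedP.
apply/clique_number_inducedP => K cl KW.
move: col => /colorable_inducedP/weight_clique_le/(_ cl).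
rewrite -sum1_card; apply: leq_trans; apply: leq_sum => x xK.
by rewrite (fintype.subsetP KW).
Qed.

(** Lovász's replication argument, run on vertex weights rather than on graphs
    with repeated vertices.  If [h x >= 2], cover first the weight lowered by
    one at [x]; one of the sets used, [A], contains [x].  Lowering the weight on
    [A] only away from [x] lowers the weight of every clique by one: a clique
    through [x] already lost one at [x], and the weight left on a clique avoiding
    [x] is covered by the sets other than [A].  So a second induction step with
    [n - 1] sets, completed by [A], covers [h]. *)
Lemma weighted_cover : perfect G ->
  forall h n, (forall K, clique G K -> \sum_(x in K) h x <= n) ->
  stable_cover h n.
Proof.
move=> /perfect_coverP perf h; have [m] := ubnP (\sum_x h x).
elim: m h => // m IH h lem n hK.
have [/existsP[x hx]|] := boolP [exists x, 1 < h x]; last first.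
  rewrite negb_exists => /forallP h1.
  have hE x : h x = (x \in [set x | h x == 1]).
    by rewrite finset.inE; move: (h1 x); case: (h x) => [|[|]].
  have [|Fs [sz st cov]] := perf [set x | h x == 1] n.
    move=> K cl /fintype.subsetP KW; apply: leq_trans (hK K cl).
    rewrite -sum1_card; apply: leq_sum => x /KW.
    by rewrite finset.inE => /eqP->.
  by exists Fs; split=> // x; rewrite hE.
have n0 : 0 < n.
  have := hK _ (clique1 G x); rewrite big_set1; apply: leq_trans; exact: ltnW.
pose h' y := h y - (y == x).
have sum_h' (P : pred V) : P x -> (\sum_(y | P y) h' y).+1 = \sum_(y | P y) h y.
  move=> Px; rewrite (bigD1 x Px) [RHS](bigD1 x Px) /= {1}/h' eqxx -addSn subn1.
  rewrite prednK; last exact: ltnW.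
  congr (_ + _); apply: eq_bigr => y /andP[_ /negPf yx].
  by rewrite /h' yx subn0.
have lem' : \sum_y h' y < m by rewrite -ltnS sum_h'.
have [|Fs [sz st cov]] := IH h' lem' n.
  move=> K cl; apply: leq_trans (hK K cl); apply: leq_sum => y _.
  exact: leq_subr.
have : has (fun F : {set V} => x \in F) Fs.
  by rewrite has_count; apply: leq_trans (cov x); rewrite /h' eqxx subn_gt0.
move=> /hasP[A AFs xA].
have cntA y : count (fun F : {set V} => y \in F) Fs
              = (y \in A) + count (fun F : {set V} => y \in F) (rem A Fs).
  have /seq.permP-> := perm_to_rem AFs; by [].
have stA : stable G A by move/allP: st => /(_ _ AFs).
have st' : all (stable G) (rem A Fs).
  by apply/allP => F /mem_rem FFs; move/allP: st; apply.
have sz' : size (rem A Fs) <= n.-1.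
  by rewrite size_rem // -subn1 -[n.-1]subn1 leq_sub2r.
pose h'' y := if y == x then h' y else h' y - (y \in A).
have le'' y : h'' y <= h' y by rewrite /h''; case: ifP => _ //; exact: leq_subr.
have lem'' : \sum_y h'' y < m by apply: leq_ltn_trans lem'; exact: leq_sum.
have [|Fs' [szF stF covF]] := IH h'' lem'' n.-1.
  move=> K cl; have [xK|xK] := boolP (x \in K).
    rewrite -ltnS prednK //; apply: leq_trans (hK K cl).
    rewrite -(sum_h' (mem K)) // ltnS; exact: leq_sum.
  have cov'' : stable_cover
      (fun y => count (fun F : {set V} => y \in F) (rem A Fs)) n.-1.
    by exists (rem A Fs); split.
  apply: leq_trans (weight_clique_le cov'' cl); apply: leq_sum => y yK.
  have yx : y == x = false by apply/negP => /eqP yx; rewrite -yx yK in xK.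
  by rewrite /h'' yx leq_subLR -cntA.
exists (A :: Fs'); split=> /=; [|by rewrite stA|].
  by rewrite -(prednK n0).
move=> y; have [->|yx] := eqVneq y x.
  rewrite xA; apply: leq_trans (leq_add (leqnn 1) (covF x)).
  by rewrite /h'' eqxx /h' eqxx add1n subn1 leqSpred.
apply: leq_trans (leq_add (leqnn _) (covF y)).
by rewrite /h'' (negPf yx) /h' (negPf yx) subn0 -leq_subLR.
Qed.

End Perfect.

(** * Fractional stable sets of perfect graphs *)

Local Open Scope ring_scope.

Section FractionalStableSets.
Context {R : realFieldType} {V : finType}.
Implicit Types (W F K S : {set V}) (y : V -> R).

Lemma sum_mem_card W F :
  \sum_(x in W) (x \in F)%:R = #|W :&: F|%:R :> R.
Proof.
rewrite -sum1_card natr_sum (eq_bigl (fun x => (x \in W) && (x \in F))).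
  rewrite [RHS]big_mkcondr; apply: eq_bigr => x _; by case: (x \in F).
by move=> x; rewrite finset.inE.
Qed.

(** Otherwise every clique [K] inside [S] misses some tight stable set [f K].
    Weigh the points [x] of [S] by the number of these cliques with [x] in [f K].
    A clique meets each [f K] in at most one point, and its trace on [S] misses
    the set chosen for this trace, so its weight is less than the number [N] of
    cliques inside [S], and [N - 1] stable sets cover the weight.  Pairing the
    weight with [y] yields [s * N] since all the [f K] are tight, but at most
    [s * (N - 1)] by the cover. *)
Lemma tight_hitting_clique (G : sgraph V) S y (s : R) : perfect G -> 0 < s ->
  (forall x, 0 <= y x) -> (forall x, x \notin S -> y x = 0) ->
  (forall F, stable G F -> \sum_(x in F) y x <= s) ->
  exists K, [/\ clique G K, K \subset S &
    forall F, stable G F -> \sum_(x in F) y x = s -> K :&: F != finset.set0].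
Proof.
move=> perf s0 y0 yS ys.
pose cl := [set K : {set V} | clique G K && (K \subset S)].
pose miss (K F : {set V}) :=
  [&& stable G F, \sum_(x in F) y x == s & K :&: F == finset.set0].
have [/exists_inP[K]|] := boolP [exists K in cl, forall F, ~~ miss K F].
  rewrite finset.inE => /andP[clK KS] /forallP hit.
  exists K; split=> // F st yF.
  by have := hit F; rewrite /miss st yF eqxx.
rewrite negb_exists => /forallP allmiss; exfalso.
have {allmiss} ex K : {F | K \in cl -> miss K F}.
  case: (pickP (miss K)) => [F mF|no]; first by exists F.
  exists finset.set0 => Kcl; have := allmiss K; rewrite Kcl /= => /negP[].
  by apply/forallP => F; rewrite no.
pose f K := sval (ex K).
have fP K : K \in cl -> miss K (f K) := svalP (ex K).
pose h x := (\sum_(K in cl) ((x \in f K) && (x \in S)))%N.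
have cl0 : finset.set0 \in cl by rewrite finset.inE clique0 finset.sub0set.
have [|Fs [sz /allP st cov]] := weighted_cover perf (h := h) (n := #|cl|.-1).
  move=> K clK; have KScl : K :&: S \in cl.
    rewrite finset.inE finset.subsetIr andbT.
    by apply: clique_sub clK; exact: finset.subsetIl.
  rewrite exchange_big /= (bigD1 (K :&: S)) //=.
  have -> : (\sum_(x in K) ((x \in f (K :&: S)) && (x \in S)) = 0)%N.
    apply: big1 => x xK; have /and3P[_ _ /eqP/finset.setP/(_ x)] := fP _ KScl.
    by rewrite !finset.inE xK /= andbC => ->.
  rewrite add0n -[#|cl|]sum1_card.
  rewrite [leqRHS](congr1 predn (bigD1 (K :&: S) _)) //= add0n.
  apply: leq_sum => L /andP[Lcl _].
  have /and3P[stL _ _] := fP _ Lcl.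
  apply: leq_trans (card_clique_stable clK stL); rewrite -sum1_card.
  rewrite [leqRHS](eq_bigl (fun x => (x \in K) && (x \in f L))).
    rewrite [leqRHS]big_mkcondr; apply: leq_sum => x _.
    by case: (x \in f L); case: (x \in S).
  by move=> x; rewrite finset.inE.
have lower : \sum_x y x * (h x)%:R = s * #|cl|%:R.
  under eq_bigr do rewrite natr_sum mulr_sumr.
  rewrite exchange_big /= -sum1_card natr_sum mulr_sumr.
  apply: eq_bigr => K Kcl; have /and3P[_ /eqP <- _] := fP _ Kcl.
  rewrite mulr1 [RHS]big_mkcond; apply: eq_bigr => x _.
  have [xS|/yS->] := boolP (x \in S); last by rewrite mul0r; case: ifP.
  by rewrite andbT; case: ifP; rewrite ?mulr1 ?mulr0.
have upper : \sum_x y x * (h x)%:R <= s * #|cl|.-1%:R.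
  apply: (@le_trans _ _ (\sum_(F <- Fs) \sum_(x in F) y x)).
    apply: (@le_trans _ _
        (\sum_x y x * (count (fun F : {set V} => x \in F) Fs)%:R)).
      by apply: ler_sum => x _; rewrite ler_wpM2l // ler_nat.
    rewrite [leRHS](eq_bigr (fun F : {set V} => \sum_x y x * (x \in F)%:R)).
      rewrite exchange_big /=; apply: ler_sum => x _.
      rewrite -mulr_sumr -sum1_count natr_sum big_mkcond.
      rewrite (eq_bigr (fun F : {set V} => (x \in F)%:R)) // => F _.
      by case: ifP.
    move=> F _; rewrite big_mkcond; apply: eq_bigr => x _.
    by case: ifP; rewrite ?mulr1 ?mulr0.
  apply: (@le_trans _ _ (\sum_(F <- Fs) s)).
    by rewrite big_seq [leRHS]big_seq; apply: ler_sum => F /st; exact: ys.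
  rewrite big_const_seq count_predT iter_addr_0 -[leLHS]mulr_natr.
  by rewrite ler_wpM2l ?ler_nat // ltW.
move: upper; rewrite lower ler_pM2l // ler_nat.
have : (0 < #|cl|)%N by apply/card_gt0P; exists finset.set0.
by case: #|cl| => // k _; rewrite ltnn.
Qed.

(** The polyhedral form of the weak perfect graph theorem.  The bound [s] is kept
    free so that a multiple [t] of a clique can be split off without
    renormalising: [s] becomes [s - t].  Taking a clique that is contained in the
    support of [y] and meets all the tight stable sets, every tight stable set
    remains tight, and the largest admissible [t] either empties a vertex of the
    support or makes a new stable set tight. *)
Lemma clique_decomposition (G : sgraph V) y (s : R) : perfect G ->
  (forall x, 0 <= y x) ->
  (forall F, stable G F -> \sum_(x in F) y x <= s) ->
  exists lam : {set V} -> R,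
    [/\ forall K, 0 <= lam K,
        forall K, lam K != 0 -> clique G K,
        \sum_K lam K = s
      & forall x, y x = \sum_K lam K * (x \in K)%:R].
Proof.
move=> perf.
have [m] := ubnP (#|[set x | y x != 0%R]|
                  + #|[set F | stable G F && (\sum_(x in F) y x != s)%R]|)%N.
elim: m y s => // m IH y s lem y0 ys.
have s_ge0 : 0 <= s.
  by have := ys _ (stable0 G); rewrite big_pred0 // => x; rewrite finset.inE.
have [s_eq0|s_neq0] := eqVneq s 0.
  exists (fun=> 0); split=> //; first by move=> K; rewrite eqxx.
    by rewrite big1.
  move=> x; rewrite big1 => [|K _]; last by rewrite mul0r.
  apply/le_anti; rewrite y0 andbT -s_eq0.
  by have := ys _ (stable1 G x); rewrite big_set1.
have s_gt0 : 0 < s by rewrite lt_neqAle eq_sym s_neq0.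
pose T := [set x | y x != 0].
have [|K [clK KT hit]] := @tight_hitting_clique G T y s perf s_gt0 y0 _ ys.
  by move=> x; rewrite finset.inE negbK => /eqP.
have yK x : x \in K -> 0 < y x.
  move=> /(fintype.subsetP KT); rewrite finset.inE => yx.
  by rewrite lt_neqAle eq_sym yx y0.
(* The largest multiple of the clique [K] that can be split off. *)
pose slack (i : V + {set V}) :=
  match i with inl x => y x | inr F => s - \sum_(x in F) y x end.
pose constr (i : V + {set V}) :=
  match i with
  | inl x => x \in K
  | inr F => stable G F && (K :&: F == finset.set0)
  end.
have c0 : constr (inr finset.set0) by rewrite /= stable0 finset.setI0 eqxx.
pose i0 := [arg min_(i < inr finset.set0 | constr i) slack i]%O.
have [ci0 mini0] : constr i0 /\ forall j, constr j -> slack i0 <= slack j.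
  by rewrite /i0; case: Order.TotalTheory.arg_minP.
pose t := slack i0.
have t_gt0 : 0 < t.
  rewrite /t; move: ci0; case: (i0) => [x|F] /=; first exact: yK.
  move=> /andP[st KF]; rewrite subr_gt0 lt_neqAle ys // andbT.
  by apply/eqP => /(hit _ st); rewrite KF.
have sumI F : stable G F ->
    \sum_(x in F) (x \in K)%:R = (K :&: F != finset.set0)%:R :> R.
  move=> st; rewrite sum_mem_card finset.setIC; have := card_clique_stable clK st.
  by rewrite -cards_eq0; case: #|_| => [|[]].
pose y' x := y x - t * (x \in K)%:R.
have sumy' F : stable G F ->
    \sum_(x in F) y' x
    = \sum_(x in F) y x - t * (K :&: F != finset.set0)%:R.
  by move=> st; rewrite sumrB -mulr_sumr sumI.
have y'0 x : 0 <= y' x.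
  rewrite /y'; have [xK|xK] := boolP (x \in K); last by rewrite mulr0 subr0.
  by rewrite mulr1 subr_ge0; exact: (mini0 (inl x)).
have y's F : stable G F -> \sum_(x in F) y' x <= s - t.
  move=> st; rewrite sumy' //; have [KF|KF] := eqVneq (K :&: F) finset.set0.
    rewrite mulr0 subr0 lerBrDr addrC -lerBrDr.
    by apply: (mini0 (inr F)); rewrite /= st KF eqxx.
  by rewrite mulr1 lerD2r ys.
have suppy' : [set x | y' x != 0] \subset T.
  apply/fintype.subsetP => x; rewrite !finset.inE; apply: contraNN => /eqP yx.
  rewrite /y'; have [xK|_] := boolP (x \in K); last by rewrite yx mulr0 subr0.
  by move: (yK x xK); rewrite yx ltxx.
have tighty' : [set F | stable G F && (\sum_(x in F) y' x != s - t)]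
               \subset [set F | stable G F && (\sum_(x in F) y x != s)].
  apply/fintype.subsetP => F; rewrite !finset.inE => /andP[st]; rewrite st /=.
  apply: contraNN => /eqP yF; rewrite sumy' // yF.
  by rewrite (hit _ st yF) mulr1.
have decr : (#|[set x | y' x != 0%R]|
    + #|[set F | stable G F && (\sum_(x in F) y' x != s - t)%R]| < m)%N.
  rewrite -ltnS; apply: leq_trans lem; rewrite ltnS.
  move: ci0 (erefl t); rewrite {2}/t; case: (i0) => [x|F] /=.
    move=> xK tE; rewrite -addSn; apply: leq_add; last exact: subset_leq_card.
    apply: proper_card; apply/properP; split=> //; exists x.
      by rewrite finset.inE gt_eqF // yK.
    by rewrite finset.inE negbK /y' xK mulr1 tE subrr.
  move=> /andP[st KF] tE; rewrite -addnS; apply: leq_add.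
    exact: subset_leq_card.
  apply: proper_card; apply/properP; split=> //; exists F.
    by rewrite finset.inE st /=; move: t_gt0; rewrite tE subr_gt0; case: ltgtP.
  by rewrite finset.inE st /= negbK sumy' // KF mulr0 subr0 tE opprB addrC subrK.
have [lam [lam0 lamcl lams lamy]] := IH y' (s - t) decr y'0 y's.
exists (fun L => lam L + t * (L == K)%:R); split.
- by move=> L; rewrite addr_ge0 ?lam0 // mulr_ge0 // ltW.
- move=> L; have [->|LK] := eqVneq L K; first by [].
  by rewrite mulr0 addr0; exact: lamcl.
- rewrite big_split /= lams -mulr_sumr (bigD1 K) //= eqxx big1.
    by rewrite addr0 mulr1 subrK.
  by move=> L /negPf->.
- move=> x; under eq_bigr do rewrite mulrDl.
  rewrite big_split /= -lamy (bigD1 K) //= big1 => [|L /negPf->].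
    by rewrite addr0 eqxx mulr1 /y' subrK.
  by rewrite mulr0 mul0r.
Qed.

(** A colouring of [W] is built greedily: it suffices to find a stable set
    meeting all the cliques of [W] of the largest size [n.+1].  If every stable
    set [F] missed such a clique [f F], consider [y = c * \sum_F 1_(f F)].  A
    stable set meets each [f F] at most once, and not at all for its own choice,
    so [y] is admissible for [c] up to [1 / (N - 1)], where [N] counts the stable
    sets, whereas [y(W) = c * N * n.+1] exceeds the bound [n.+1] as soon as
    [c > 1 / N]. *)
Lemma perfect_of_clique_bound (G : sgraph V) :
  (forall y, (forall x, 0 <= y x) ->
     (forall F, stable G F -> \sum_(x in F) y x <= 1) ->
   forall W, exists K,
     [/\ clique G K, K \subset W & \sum_(x in W) y x <= #|K|%:R]) ->
  perfect G.
Proof.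
move=> bound; apply/perfect_coverP => W n; elim: n W => [|n IH] W leW.
  exists [::]; split=> // x; have [xW|//] := boolP (x \in W).
  by have := leW _ (clique1 G x); rewrite finset.sub1set cards1 => /(_ xW).
have [/exists_inP[F stF /forallP hit]|] := boolP [exists F in stable G,
    forall K, clique G K && (K \subset W) && (#|K| == n.+1) ==>
              (K :&: F != finset.set0)].
  have [|Fs [sz st cov]] := IH (W :\: F).
    move=> K clK; rewrite finset.subsetD => /andP[KW KF].
    rewrite -ltnS ltn_neqAle leW // andbT; apply/negP => cardK.
    by have := hit K; rewrite clK KW cardK finset.setI_eq0 KF.
  exists (F :: Fs); split=> //=; first by apply/andP.
  move=> x; apply: leq_trans (leq_add (leqnn _) (cov x)).
  by rewrite !finset.inE; case: (x \in F); case: (x \in W).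
rewrite negb_exists_in => /forall_inP nohit; exfalso.
pose miss (F K : {set V}) :=
  [&& clique G K, K \subset W, #|K| == n.+1 & K :&: F == finset.set0].
have {nohit} ex F : {K | stable G F -> miss F K}.
  case: (pickP (miss F)) => [K mK|no]; first by exists K.
  exists finset.set0 => st; have /negP[] := nohit _ st.
  apply/forallP => K; apply/implyP => /andP[/andP[cl KW] cK].
  by apply/negP => KF; have := no K; rewrite /miss cl KW cK KF.
pose f F := sval (ex F).
have fP F : stable G F -> miss F (f F) := svalP (ex F).
pose N := #|[set F | stable G F]|.
have N0 : (0 < N)%N.
  by apply/card_gt0P; exists finset.set0; rewrite finset.inE stable0.
(* A factor between [1 / N] and [1 / (N - 1)], also defined if [N] is 1. *)
pose c : R := (N%:R - 2^-1)^-1.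
have N1 : 1 <= N%:R :> R by rewrite ler1n.
have c_gt0 : 0 < c by rewrite invr_gt0; lra.
pose y x := c * \sum_(F | stable G F) (x \in f F)%:R.
have sumy (A : {set V}) :
    \sum_(x in A) y x = c * \sum_(F | stable G F) #|A :&: f F|%:R.
  by rewrite -mulr_sumr exchange_big; under eq_bigr do rewrite sum_mem_card.
have y0 x : 0 <= y x by rewrite mulr_ge0 ?(ltW c_gt0) // sumr_ge0.
have cN : c * (N%:R - 2^-1) = 1 by rewrite mulVf //; apply/eqP; lra.
have [|K [clK KW]] := bound y y0 _ W.
  move=> F st; rewrite sumy (bigD1 F) //=.
  have /and4P[_ _ _] := fP _ st; rewrite finset.setIC => /eqP->.
  rewrite cards0 add0r -[leRHS]cN ler_pM2l //.
  apply: (@le_trans _ _ (N.-1)%:R); last by rewrite -subn1 natrB //; lra.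
  rewrite -natr_sum ler_nat /N -sum1dep_card [in leqRHS](bigD1 F) //=.
  apply: leq_sum => F' /andP[st' _].
  have /and4P[cl _ _ _] := fP _ st'.
  by rewrite finset.setIC; exact: card_clique_stable cl st.
apply/negP; rewrite -ltNge sumy.
have -> : \sum_(F | stable G F) #|W :&: f F|%:R = N%:R * n.+1%:R :> R.
  rewrite /N -sum1dep_card natr_sum mulr_suml; apply: eq_bigr => F st.
  have /and4P[_ fW /eqP cf _] := fP _ st.
  by rewrite mul1r; move/finset.setIidPr: fW => ->; rewrite cf.
apply: (@le_lt_trans _ _ n.+1%:R); first by rewrite ler_nat leW.
rewrite mulrA ltr_pMl ?ltr0n //; lra.
Qed.

End FractionalStableSets.

(** The graph is forced: its edges are the pairs that are not faces.  The bound
    applied to a multiple of the indicator of a set [W] stable for this graph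
    shows that [W] is a face, which is where complexes that are not determined by
    their edges are excluded. *)
Lemma stable_sets_of_bound (R : realFieldType) (d : nat) (D : {set {set 'I_d}}) :
  simplicial_complex D ->
  (forall y : 'I_d -> R, (forall x, 0 <= y x) ->
     (forall F, F \in D -> \sum_(x in F) y x <= 1) ->
   forall W : {set 'I_d}, exists C : {set 'I_d},
     [/\ C \subset W, forall F, F \in D -> (#|C :&: F| <= 1)%N
       & \sum_(x in W) y x <= #|C|%:R]) ->
  exists G : sgraph 'I_d, perfect G /\ D = stable_sets G.
Proof.
move=> [D0 D1 Dsub] bound.
pose e : rel 'I_d := fun i j => (i != j) && ([set i; j] \notin D).
have e_sym : symmetric e by move=> i j; rewrite /e eq_sym finset.setUC.
have e_irr : irreflexive e by move=> i; rewrite /e eqxx.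
pose G := SGraph e_sym e_irr.
have cliqueC (C : {set 'I_d}) :
    (forall F, F \in D -> (#|C :&: F| <= 1)%N) -> clique G C.
  move=> C1; apply/cliqueP => i j iC jC ij; rewrite /= /e ij /=.
  apply/negP => /C1; rewrite leqNgt => /negP[].
  rewrite (_ : C :&: _ = [set i; j]) ?cards2 ?ij //.
  by apply/finset.setIidPr/fintype.subsetP => k /set2P[]->.
have DG : D = stable_sets G.
  apply/finset.setP => W; rewrite finset.inE; apply/idP/idP => [WD|/stableP st].
    apply/stableP => i j iW jW; rewrite /= /e negb_and !negbK.
    apply/orP; right; apply: Dsub WD _.
    by apply/fintype.subsetP => k /set2P[]->.
  apply: contraT => WD.
  have W0 : (0 < #|W|)%N.
    by rewrite card_gt0; apply: contraNneq WD => ->.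
  have W1 : 1 <= #|W|%:R :> R by rewrite ler1n.
  (* A factor between [1 / #|W|] and [1 / (#|W| - 1)], for faces meet [W] in at
     most [#|W| - 1] points. *)
  pose c : R := (#|W|%:R - 2^-1)^-1.
  have c_gt0 : 0 < c by rewrite invr_gt0; lra.
  have cW : c * (#|W|%:R - 2^-1) = 1 by rewrite mulVf //; apply/eqP; lra.
  have sumc (F : {set 'I_d}) :
      \sum_(x in F) c * (x \in W)%:R = c * #|F :&: W|%:R.
    by rewrite -mulr_sumr sum_mem_card.
  have [||C [CW /cliqueC/cliqueP clC]] :=
      bound (fun x => c * (x \in W)%:R) _ _ W.
  - by move=> x; rewrite mulr_ge0 // ltW.
  - move=> F FD; rewrite sumc -[leRHS]cW ler_pM2l //.
    apply: (@le_trans _ _ (#|W|.-1)%:R); last by rewrite -subn1 natrB //; lra.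
    rewrite ler_nat -ltnS prednK // ltn_neqAle subset_leq_card ?andbT.
      apply: contra WD => /eqP cFW; apply: Dsub FD _.
      by apply/finset.setIidPr/eqP; rewrite eqEcard finset.subsetIr cFW /=.
    exact: finset.subsetIr.
  rewrite sumc finset.setIid => le_cC.
  have /card_gt1P[i [j [iC jC ij]]] : (1 < #|C|)%N.
    rewrite -(ltr_nat R); apply: lt_le_trans le_cC; lra.
  have /negP[] := st i j (fintype.subsetP CW i iC) (fintype.subsetP CW j jC).
  exact: clC.
exists G; split=> //; apply: (@perfect_of_clique_bound R) => y y0 yF W.
have [|C [CW /cliqueC clC le]] := bound y y0 _ W; last by exists C.
by move=> F; rewrite DG finset.inE; exact: yF.
Qed.

(** * Convex hulls and vertices *)

Import numFieldNormedType.Exports.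
Local Open Scope classical_set_scope.

Section ConvexHull.
Context {R : realType} {d : nat}.
Local Notation rV := 'rV[R]_d.
Implicit Types (A B Q : set rV) (c v x y : rV) (s : seq rV).

Lemma convex_setP A :
  convex_set A <-> (forall x y (a b : R), 0 <= a -> 0 <= b -> a + b = 1 ->
                      A x -> A y -> A (a *: x + b *: y)).
Proof.
split=> [cA x y a b a0 b0 ab Ax Ay|cA x y l].
  have a1 : a <= 1 by rewrite -ab lerDl.
  have -> : b = 1 - a by rewrite -ab addrC addKr.
  have := cA x y (Itv01 a0 a1); rewrite !in_setE; exact.
rewrite !in_setE => Ax Ay; apply: cA => //.
  by rewrite unstable.onem_ge0.
exact: unstable.add_onemK.
Qed.

Lemma convex_conv_hull A : convex_set (conv_hull A).
Proof.
apply/convex_setP => x y a b a0 b0 ab Ax Ay B [cB AB].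
by have /convex_setP := cB; apply => //; [exact: Ax|exact: Ay].
Qed.

Lemma sub_conv_hull A : A `<=` conv_hull A.
Proof. exact: sub_gen_smallest. Qed.

Lemma conv_hull_sub A B : convex_set B -> A `<=` B -> conv_hull A `<=` B.
Proof. exact: smallest_sub. Qed.

Lemma dotvC x y : dotv x y = dotv y x.
Proof. by apply: eq_bigr => i _; rewrite mulrC. Qed.

Lemma dotv_lin c x y (a b : R) :
  dotv c (a *: x + b *: y) = a * dotv c x + b * dotv c y.
Proof.
rewrite /dotv !mulr_sumr -big_split; apply: eq_bigr => i _ /=.
by rewrite !mxE; ring.
Qed.

Lemma dotvZl c x (a : R) : dotv (a *: c) x = a * dotv c x.
Proof. by rewrite /dotv mulr_sumr; apply: eq_bigr => i _; rewrite mxE mulrA. Qed.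

Lemma dotvDl c c' x : dotv (c + c') x = dotv c x + dotv c' x.
Proof.
by rewrite /dotv -big_split; apply: eq_bigr => i _; rewrite mxE mulrDl.
Qed.

Lemma dotvBr c x y : dotv c (x - y) = dotv c x - dotv c y.
Proof.
by rewrite -[x]scale1r -scaleN1r dotv_lin scale1r mul1r mulN1r.
Qed.

Lemma dotv_gt0 x : x != 0 -> 0 < dotv x x.
Proof.
move=> x0; have sq i : 0 <= x 0 i * x 0 i by rewrite -expr2 sqr_ge0.
rewrite lt_neqAle sumr_ge0 // andbT eq_sym psumr_eq0 //.
apply: contra x0 => /allP x0; apply/eqP/matrixP => i j; rewrite ord1 mxE.
by have := x0 j (mem_index_enum j); rewrite mulf_eq0 orbb => /eqP.
Qed.

Lemma convex_dotv_le c (b : R) : convex_set [set x | dotv c x <= b].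
Proof.
apply/convex_setP => x y a a' a0 a0' aa' /= cx cy; rewrite dotv_lin.
have -> : b = a * b + a' * b by rewrite -mulrDl aa' mul1r.
by apply: lerD; apply: ler_wpM2l.
Qed.

Lemma convex_dotv_lt c (b : R) : convex_set [set x | dotv c x < b].
Proof.
apply/convex_setP => x y a a' a0 a0' aa' /= cx cy; rewrite dotv_lin.
have [a_eq0|a_neq0] := eqVneq a 0.
  by move: aa'; rewrite a_eq0 add0r => ->; rewrite mul0r add0r mul1r.
have -> : b = a * b + a' * b by rewrite -mulrDl aa' mul1r.
apply: ltr_leD; last by apply: ler_wpM2l => //; exact: ltW.
by rewrite ltr_pM2l // lt_neqAle eq_sym a_neq0.
Qed.

(** An open half-space together with one point of its boundary is convex; this is
    what shows that a strict maximiser among the generators of a hull is a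
    vertex of the hull. *)
Lemma convex_strict_halfspace c v :
  convex_set [set x | x = v \/ dotv c x < dotv c v].
Proof.
apply/convex_setP => x y a b a0 b0 ab /= cx cy.
have [a_eq0|a_neq0] := eqVneq a 0.
  by rewrite a_eq0 add0r in ab *; rewrite ab scale0r scale1r add0r.
have [b_eq0|b_neq0] := eqVneq b 0.
  by rewrite b_eq0 addr0 in ab *; rewrite ab scale0r scale1r addr0.
have a_gt0 : 0 < a by rewrite lt_neqAle eq_sym a_neq0.
have b_gt0 : 0 < b by rewrite lt_neqAle eq_sym b_neq0.
move: cx cy => [->|cx] [->|cy]; first by rewrite -scalerDl ab scale1r; left.
all: right; rewrite dotv_lin.
all: rewrite -[ltRHS]mul1r -ab mulrDl.
- by rewrite ltrD2l ltr_pM2l.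
- by rewrite ltrD2r ltr_pM2l.
- by apply: ltrD; rewrite ltr_pM2l.
Qed.

(** The weights are only assumed to be supported in [A], so that a sum over all
    sets of vertices can stand for a sum over cliques. *)
Lemma convex_sum A (I : finType) (l : I -> R) (p : I -> rV) : convex_set A ->
  (forall i, 0 <= l i) -> (forall i, l i != 0 -> A (p i)) ->
  \sum_i l i = 1 -> A (\sum_i l i *: p i).
Proof.
move=> /convex_setP cA l0 Ap.
suff part (r : seq I) : 0 < \sum_(i <- r) l i ->
    A ((\sum_(i <- r) l i)^-1 *: (\sum_(i <- r) l i *: p i)).
  by move=> l1; have := part (index_enum I); rewrite l1 invr1 scale1r; exact.
elim: r => [|i r IH]; first by rewrite big_nil ltxx.
rewrite !big_cons; set t := \sum_(j <- r) l j.
have t0 : 0 <= t by apply: sumr_ge0.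
have [li0|li_neq0] := eqVneq (l i) 0.
  by rewrite li0 scale0r !add0r; exact: IH.
have li_gt0 : 0 < l i by rewrite lt_neqAle eq_sym li_neq0 l0.
move=> lt_gt0; have [t_eq0|t_neq0] := eqVneq t 0.
  have -> : \sum_(j <- r) l j *: p j = 0.
    rewrite big_seq big1 // => j jr; suff -> : l j = 0 by rewrite scale0r.
    move/eqP: t_eq0; rewrite /t psumr_eq0 // => /allP/(_ j jr)/=.
    by move/eqP.
  by rewrite t_eq0 !addr0 scalerA mulVf // scale1r; exact: Ap.
have t_gt0 : 0 < t by rewrite lt_neqAle eq_sym t_neq0.
have -> : (l i + t)^-1 *: (l i *: p i + \sum_(j <- r) l j *: p j)
    = (l i / (l i + t)) *: p i
      + (t / (l i + t)) *: (t^-1 *: \sum_(j <- r) l j *: p j).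
  rewrite scalerDr !scalerA; congr (_ *: _ + _ *: _); first by rewrite mulrC.
  by field; rewrite t_neq0 gt_eqF.
apply: cA; [by rewrite divr_ge0 // ltW|by rewrite divr_ge0 // ltW| | |].
- by rewrite -mulrDl divff // gt_eqF.
- exact: Ap.
- exact: IH.
Qed.

(** If the vertex were not in [A], the open half-space cut out by its supporting
    hyperplane would be a convex set containing [A], but not the vertex. *)
Lemma vertex_conv_hull A v : is_vertex (conv_hull A) v -> A v.
Proof.
move=> [a [b [le_b /seteqP[sub1 sub2]]]].
have [hv av] := sub2 v erefl.
apply: contrapT => Av; have : [set x | dotv a x < b] v.
  apply: (conv_hull_sub _ _ hv); first exact: convex_dotv_lt.
  move=> x Ax /=; rewrite lt_neqAle le_b ?andbT; last exact: sub_conv_hull.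
  apply/eqP => ax; apply: Av; rewrite -(sub1 x) //.
  by split => //; exact: sub_conv_hull.
by rewrite /= av ltxx.
Qed.

End ConvexHull.

Lemma seq_argmax (R : realDomainType) (T : eqType) (s : seq T) (f : T -> R) :
  s != [::] -> exists2 v, v \in s & forall x, x \in s -> f x <= f v.
Proof.
elim: s => // x s IH _; have [->|/IH[v vs vmax]] := eqVneq s [::].
  by exists x; rewrite ?mem_head // => y; rewrite inE => /eqP->.
have [le|lt] := leP (f x) (f v).
  exists v; first by rewrite inE vs orbT.
  by move=> y; rewrite inE => /predU1P[->//|]; exact: vmax.
exists x; first exact: mem_head.
by move=> y; rewrite inE => /predU1P[->//|/vmax /le_trans]; apply; exact: ltW.
Qed.

(** Makes the lexicographic maximisation of [g] and then [h] over a finite set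
    the maximisation of a single combination [N * g + h]. *)
Lemma seq_dominate (R : realFieldType) (T : eqType) (s : seq T) (g h : T -> R) :
  exists2 N, 0 <= N & forall x, x \in s -> g x < 0 -> N * g x + h x < 0.
Proof.
elim: s => [|x s [N N0 NP]]; first by exists 0.
have [gx|gx] := leP 0 (g x).
  exists N => // y; rewrite inE => /predU1P[->|]; last exact: NP.
  by rewrite ltNge gx.
pose M := `|h x| / - g x + 1.
have M0 : 0 <= M by rewrite addr_ge0 // divr_ge0 // oppr_ge0 ltW.
exists (N + M); first exact: addr_ge0.
move=> y; rewrite inE => /predU1P[-> _|ys gy].
  have Mg : M * g x = - `|h x| + g x.
    by rewrite /M; field; rewrite lt_eqF.
  by have := ler_norm (h x); nra.
by have := NP y ys gy; nra.
Qed.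

(** Among the generators where [c] is maximal, take [v] of largest norm.  Then
    [dotv v] is strictly maximal at [v] among them, because the other ones are at
    a positive distance from [v] and have no larger norm, and [N *: c + v]
    exposes [v] for large [N]. *)
Lemma polytope_max_vertex (R : realType) (d : nat) (Q : set 'rV[R]_d) c :
  is_polytope Q -> Q !=set0 ->
  exists2 v, is_vertex Q v & forall x, Q x -> dotv c x <= dotv c v.
Proof.
move=> [s ->] [x0 Qx0].
have s0 : s != [::].
  apply: contraPneq Qx0 => -> hx0.
  suff : (set0 : set 'rV[R]_d) x0 by [].
  by apply: (conv_hull_sub _ _ hx0) => [|x //]; apply/convex_setP.
have [u us umax] := seq_argmax (dotv c) s0.
have s0' : [seq x <- s | dotv c x == dotv c u] != [::].
  by rewrite -has_filter; apply/hasP; exists u.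
have [v] := seq_argmax (fun x => dotv x x) s0'.
rewrite mem_filter => /andP[/eqP cvu vs] vmax.
have cmax x : x \in s -> dotv c x <= dotv c v by rewrite cvu; exact: umax.
have [N N0 NP] := seq_dominate s (fun x => dotv c x - dotv c v)
                                 (fun x => dotv v x - dotv v v).
pose a := N *: c + v.
have aE x : dotv a x = N * dotv c x + dotv v x by rewrite dotvDl dotvZl.
have amax x : x \in s -> x = v \/ dotv a x < dotv a v.
  move=> xs; have [->|xv] := eqVneq x v; [by left|right].
  rewrite -subr_lt0 !aE.
  have [cxv|cxv] := eqVneq (dotv c x) (dotv c v); last first.
    have lt_cx : dotv c x - dotv c v < 0 by rewrite subr_lt0 lt_neqAle cxv cmax.
    by have := NP x xs lt_cx; lra.
  have := vmax x; rewrite mem_filter xs cxv cvu eqxx => /(_ isT).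
  have : 0 < dotv (x - v) (x - v) by rewrite dotv_gt0 // subr_eq0.
  rewrite dotvBr !(dotvC (x - v)) !dotvBr (dotvC x v); lra.
have hull_max x : conv_hull [set` s] x -> x = v \/ dotv a x < dotv a v.
  apply: (@conv_hull_sub _ _ _ [set x | x = v \/ dotv a x < dotv a v]) => //.
  exact: convex_strict_halfspace.
exists v.
  exists a, (dotv a v); split=> [x /hull_max[->//|/ltW//]|].
  apply/seteqP; split=> [x [/hull_max[->//|]] /= + ax|_ ->].
    by rewrite ax ltxx.
  by split=> //; apply: sub_conv_hull.
move=> x; apply: (@conv_hull_sub _ _ _ [set x | dotv c x <= dotv c v]).
  exact: convex_dotv_le.
by move=> y /= /cmax.
Qed.

(** * The polytope of two simplicial complexes and its dual *)

Lemma sum_unlift0 (V : nmodType) (n : nat) (f : option 'I_n -> V) :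
  \sum_(k < n.+1) f (unlift ord0 k) = f None + \sum_(i < n) f (Some i).
Proof.
rewrite big_ord_recl unlift_none; congr (_ + _).
by apply: eq_bigr => i _; rewrite liftK.
Qed.

Section RhoPoints.
Context {R : realType} {d : nat}.
Implicit Types (F W : {set 'I_d}) (y : 'rV[R]_d).

Lemma rhoE F i : (rho F : 'rV[R]_d) 0 i = (i \in F)%:R.
Proof.
rewrite /rho summxE; under eq_bigr do rewrite mxE eqxx /=.
have [iF|iF] := boolP (i \in F).
  rewrite (bigD1 i) //= eqxx big1 ?addr0 // => j /andP[_ /negPf].
  by rewrite eq_sym => ->.
by rewrite big1 // => j jF; have [ij|//] := eqVneq i j; rewrite ij jF in iF.
Qed.

Lemma rho0 : rho finset.set0 = 0 :> 'rV[R]_d.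
Proof. by rewrite /rho big_pred0 // => i; rewrite finset.inE. Qed.

Lemma dotv_rho F y : dotv (rho F) y = \sum_(i in F) y 0 i.
Proof.
rewrite /dotv [RHS]big_mkcond; apply: eq_bigr => i _.
by rewrite rhoE; case: ifP; rewrite ?mul1r ?mul0r.
Qed.

Lemma integer_rho F : integer_point (rho F : 'rV[R]_d).
Proof. by apply/mxOverP => i j; rewrite ord1 rhoE intr_nat. Qed.

End RhoPoints.

Section TwinnedPolytope.
Context {R : realType} {d : nat} (D D' : {set {set 'I_d}}).
Hypotheses (hD : simplicial_complex D) (hD' : simplicial_complex D').

Definition twinned_points : seq 'rV[R]_d :=
  [seq rho F | F <- enum D] ++ [seq - rho F | F <- enum D'].

Definition twinned_polytope : set 'rV[R]_d := conv_hull [set` twinned_points].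

Lemma twinned_pointP v : v \in twinned_points <->
  (exists2 F, F \in D & v = rho F) \/ (exists2 F, F \in D' & v = - rho F).
Proof.
rewrite mem_cat; split=> [/orP[]/mapP[F + ->]|[|][F FD ->]].
- by rewrite mem_enum => FD; left; exists F.
- by rewrite mem_enum => FD; right; exists F.
- by apply/orP; left; apply/mapP; exists F; rewrite // mem_enum.
- by apply/orP; right; apply/mapP; exists F; rewrite // mem_enum.
Qed.

Lemma twinned_polytopeE :
  conv_hull (complex_polytope D `|` [set - v | v in complex_polytope D'])
  = twinned_polytope.
Proof.
have convT : convex_set twinned_polytope by exact: convex_conv_hull.
apply/seteqP; split.
  apply: conv_hull_sub => // x [|[v + <-]].
    apply: conv_hull_sub => // _ [F /= FD <-].
    by apply: sub_conv_hull; apply/twinned_pointP; left; exists F.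
  apply: (@conv_hull_sub _ _ _ [set v | twinned_polytope (- v)])
    => [|_ [F /= FD <-]].
    apply/convex_setP => u w a b a0 b0 ab /= Tu Tw.
    rewrite opprD -!scalerN; by move/convex_setP: convT; apply.
  by apply: sub_conv_hull; apply/twinned_pointP; right; exists F.
apply: conv_hull_sub; first exact: convex_conv_hull.
move=> v /= /twinned_pointP[[F FD ->]|[F FD ->]]; apply: sub_conv_hull.
  by left; apply: sub_conv_hull; exists F.
by right; exists (rho F) => //; apply: sub_conv_hull; exists F.
Qed.

Lemma twinned_rho F : F \in D -> twinned_polytope (rho F).
Proof.
by move=> FD; apply: sub_conv_hull; apply/twinned_pointP; left; exists F.
Qed.

Lemma twinned_oppr_rho F : F \in D' -> twinned_polytope (- rho F).
Proof.
by move=> FD; apply: sub_conv_hull; apply/twinned_pointP; right; exists F.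
Qed.

Lemma twinned0 : twinned_polytope 0.
Proof. by rewrite -rho0; apply: twinned_rho; case: hD. Qed.

Lemma twinned_coord_le1 x i : twinned_polytope x -> `|x 0 i| <= 1.
Proof.
apply: (@conv_hull_sub _ _ _ [set x | `|x 0 i| <= 1]) => [|v /=].
  apply/convex_setP => u v a b a0 b0 ab /=; rewrite !mxE !ler_norml.
  move=> /andP[u1 u2] /andP[v1 v2]; apply/andP; split; nra.
move=> /twinned_pointP[][F FD ->] /=; rewrite ?mxE rhoE ?normrN;
  by case: (i \in F); rewrite ?normr1 ?normr0.
Qed.

Lemma has_dim_twinned : has_dim twinned_polytope d.
Proof.
exists 0, 1%:M; split; first exact: mxrank1.
apply/seteqP; split=> x _ /=; first exact: submx1.
have [D0 D1 _] := hD.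
exists d.+1.
exists (fun k => oapp (fun i => x 0 i) (1 - \sum_i x 0 i) (unlift ord0 k)).
exists (fun k => oapp (fun i => rho [set i]%SET) 0 (unlift ord0 k)); split.
- move=> k; case: (unlift ord0 k) => [i|] /=; last exact: twinned0.
  by apply: twinned_rho; exact: D1.
- by rewrite (sum_unlift0 (oapp (fun i => x 0 i) _)) /= subrK.
rewrite (sum_unlift0 (fun o => oapp (fun i => x 0 i) _ o
                               *: oapp (fun i => rho [set i]%SET) 0 o)) /=.
rewrite scaler0 add0r [LHS]row_sum_delta; apply: eq_bigr => i _.
by rewrite /rho big_set1.
Qed.

Lemma interior_twinned :
  interior twinned_polytope `&` @integer_point R d = [set 0].
Proof.
apply/seteqP; split=> [x [/nbhs_ballP[e /= e0 ball_e] /mxOverP xint]|_ ->].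
  apply/matrixP => k i; rewrite ord1 mxE {k}; apply/eqP/negPn/negP => xi0.
  pose z := x + (e / 2 * Num.sg (x 0 i)) *: delta_mx 0 i.
  have : ball x e z.
    split=> // k j; rewrite ord1 /ball /= !mxE eqxx /=.
    rewrite opprD addrA subrr sub0r normrN.
    have [_|_] := eqVneq j i; rewrite ?mulr0 ?normr0 // mulr1.
    rewrite normrM normr_sg xi0 mulr1 ger0_norm; lra.
  move=> /ball_e /(twinned_coord_le1 i); rewrite !mxE !eqxx mulr1.
  rewrite {1}[x 0 i]numEsg mulrC -mulrDl normrM normr_sg xi0 mulr1.
  have x1 : 1 <= `|x 0 i| by apply: norm_intr_ge1.
  rewrite ger0_norm; lra.
split; last by apply/mxOverP => i j; rewrite mxE.
apply/nbhs_ballP; exists (d.+1%:R^-1) => //= x [_ xball].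
have xi i : `|x 0 i| <= d.+1%:R^-1.
  by have := xball 0 i; rewrite /ball /= mxE sub0r normrN; exact: ltW.
have sum_le1 : \sum_i `|x 0 i| <= 1.
  apply: (@le_trans _ _ (\sum_(i < d) d.+1%:R^-1)); first exact: ler_sum.
  rewrite sumr_const card_ord -[leLHS]mulr_natl ler_pdivrMr ?ltr0n //.
  by rewrite mul1r ler_nat.
pose l := oapp (fun i => `|x 0 i|) (1 - \sum_i `|x 0 i|).
pose p := oapp (fun i => Num.sg (x 0 i) *: rho [set i]%SET) (0 : 'rV[R]_d).
have -> : x = \sum_(k < d.+1) l (unlift ord0 k) *: p (unlift ord0 k).
  rewrite (sum_unlift0 (fun o => l o *: p o)) /= scaler0 add0r.
  rewrite [LHS]row_sum_delta; apply: eq_bigr => i _.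
  by rewrite scalerA mulrC -numEsg /rho big_set1.
have [_ D1 _] := hD; have [_ D1' _] := hD'.
apply: convex_sum; first exact: convex_conv_hull.
- by move=> k; case: unlift => [i|] //=; rewrite subr_ge0.
- move=> k _; case: unlift => [i|] /=; last exact: twinned0.
  case: sgrP => _; rewrite ?scale0r ?scale1r ?scaleN1r.
  + exact: twinned0.
  + by apply: twinned_rho; exact: D1.
  + by apply: twinned_oppr_rho; exact: D1'.
- by rewrite sum_unlift0 /= subrK.
Qed.

Lemma integral_conv_hull (s : seq 'rV[R]_d) :
  (forall v, v \in s -> integer_point v) ->
  integral_polytope (conv_hull [set` s]).
Proof. by move=> sint; split=> [|v /vertex_conv_hull /sint //]; exists s. Qed.

Lemma fano_twinned : fano_polytope twinned_polytope.
Proof.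
split; [|exact: has_dim_twinned|exact: interior_twinned].
apply: integral_conv_hull => v /twinned_pointP[][F _ ->].
  exact: integer_rho.
by apply/mxOverP => i j; rewrite mxE rpredN; exact/mxOverP/integer_rho.
Qed.

Lemma dual_twinnedP y : dual_polytope twinned_polytope y <->
  (forall F, F \in D -> \sum_(i in F) y 0 i <= 1) /\
  (forall F, F \in D' -> \sum_(i in F) - y 0 i <= 1).
Proof.
split=> [dual|[yD yD'] x].
  split=> F FD; first by rewrite -dotv_rho; apply: dual; exact: twinned_rho.
  rewrite sumrN -dotv_rho -mulN1r -dotvZl scaleN1r.
  by apply: dual; exact: twinned_oppr_rho.
apply: (@conv_hull_sub _ _ _ [set x | dotv x y <= 1]) => [|v /=].
  rewrite (_ : [set x | _] = [set x | dotv y x <= 1]).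
    exact: convex_dotv_le.
  by apply/seteqP; split=> z /=; rewrite dotvC.
move=> /twinned_pointP[][F FD ->] /=; first by rewrite dotv_rho yD.
by rewrite -scaleN1r dotvZl mulN1r dotv_rho -sumrN yD'.
Qed.

End TwinnedPolytope.

(** Stated for a sign [e] so that it covers both the part of the dual polytope
    governed by [D] and the opposite part governed by [D']. *)
Lemma bound_of_integral_polytope (R : realType) (d : nat) (D : {set {set 'I_d}})
    (e : R) (Q : set 'rV[R]_d) :
  simplicial_complex D -> e * e = 1 -> e \is a Num.int -> integral_polytope Q ->
  (forall y, Q y -> forall F, F \in D -> \sum_(i in F) e * y 0 i <= 1) ->
  (forall y : 'rV[R]_d, (forall i, 0 <= y 0 i) ->
     (forall F, F \in D -> \sum_(i in F) y 0 i <= 1) -> Q (e *: y)) ->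
  forall y : 'I_d -> R, (forall x, 0 <= y x) ->
     (forall F, F \in D -> \sum_(x in F) y x <= 1) ->
   forall W : {set 'I_d}, exists C : {set 'I_d},
     [/\ C \subset W, forall F, F \in D -> (#|C :&: F|%SET <= 1)%N
       & \sum_(x in W) y x <= #|C|%:R].
Proof.
move=> [D0 D1 Dsub] ee eint [Qpoly Qint] Qle Qge y y0 yD W.
pose Y := \row_i y i : 'rV[R]_d.
have QY : Q (e *: Y).
  apply: Qge => [i|F FD]; first by rewrite mxE.
  by under eq_bigr do rewrite mxE; exact: yD.
have [v vQ vmax] :=
  @polytope_max_vertex R d Q (e *: rho W) Qpoly (ex_intro _ _ QY).
have Qv : Q v.
  by case: vQ => a [b [_ /seteqP[_ /(_ v erefl)[]]]].
pose u i := e * v 0 i.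
have uD F : F \in D -> \sum_(i in F) u i <= 1 by exact: Qle.
have ule1 i : u i <= 1 by have := uD _ (D1 i); rewrite big_set1.
have uint i : u i \is a Num.int.
  by rewrite rpredM //; have /mxOverP := Qint v vQ; apply.
have u0 i : u i < 1 -> u i <= 0.
  by have /intrP[m ->] := uint i; rewrite ltrz1 lerz0 -ltzD1.
exists [set i in W | 1 <= u i]%SET; split.
- by apply/fintype.subsetP => i; rewrite finset.inE => /andP[].
- move=> F FD; set C := finset _; rewrite -(ler_nat R).
  have CFD : (C :&: F)%SET \in D by apply: Dsub FD _; exact: finset.subsetIr.
  apply: le_trans (uD _ CFD); rewrite -sum1_card natr_sum.
  by apply: ler_sum => i; rewrite !finset.inE => /andP[/andP[]].
have := vmax _ QY; rewrite !dotvZl !dotv_rho.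
have -> : e * \sum_(i in W) (e *: Y) 0 i = \sum_(i in W) y i.
  by rewrite mulr_sumr; apply: eq_bigr => i _; rewrite !mxE mulrA ee mul1r.
move=> /le_trans; apply; rewrite mulr_sumr -sum1_card natr_sum.
rewrite big_mkcond [leRHS]big_mkcond; apply: ler_sum => i _.
rewrite finset.inE; case: (i \in W) => //=.
by case: ifPn => [_|]; [exact: ule1|rewrite -ltNge; exact: u0].
Qed.

(** The dual is the convex hull of the differences [rho K - rho K'] with [K] a
    clique of [G] and [K'] a clique of [G'].  A point of the dual is the
    difference of its positive and negative parts, and each of them is a convex
    combination of cliques: dropping the negative terms of a sum over a stable
    set amounts to passing to a smaller stable set. *)
Lemma integral_dual_twinned (R : realType) (d : nat) (G G' : sgraph 'I_d) :
  perfect G -> perfect G' ->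
  integral_polytope (dual_polytope
    (@twinned_polytope R d (stable_sets G) (stable_sets G'))).
Proof.
move=> perf perf'; set Q := dual_polytope _.
pose T := [seq rho p.1 - rho p.2 : 'rV[R]_d |
            p <- enum [set p : {set 'I_d} * {set 'I_d} |
                        clique G p.1 && clique G' p.2]%SET].
have rhoT K K' : clique G K -> clique G' K' -> rho K - rho K' \in T.
  move=> clK clK'; apply/mapP; exists (K, K') => //.
  by rewrite mem_enum finset.inE clK clK'.
suff -> : Q = conv_hull [set` T].
  apply: integral_conv_hull => v /mapP[[K K'] _ ->].
  by apply/mxOverP => i j; rewrite !mxE rpredB //; exact/mxOverP/integer_rho.
apply/seteqP; split=> [y|].
  move=> /dual_twinnedP[yD yD'].
  have pos (H : sgraph 'I_d) (z : 'I_d -> R) : perfect H ->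
      (forall F, F \in stable_sets H -> \sum_(i in F) z i <= 1) ->
      exists lam : {set 'I_d} -> R,
        [/\ forall K, 0 <= lam K, forall K, lam K != 0 -> clique H K,
            \sum_K lam K = 1
          & forall x, Num.max (z x) 0 = \sum_K lam K * (x \in K)%:R].
    move=> perfH zF; apply: clique_decomposition => // [x|F st].
      by rewrite le_max lexx orbT.
    have /zF : (F :&: [set i | 0 <= z i])%SET \in stable_sets H.
      by rewrite finset.inE; apply: stable_sub st; exact: finset.subsetIl.
    apply: le_trans; rewrite [leRHS](eq_bigl (fun i => (i \in F) && (0 <= z i))).
      rewrite [leRHS]big_mkcondr; apply: ler_sum => i _.
      by have [z0|/ltW z0] := leP 0 (z i).
    by move=> i; rewrite !finset.inE.
  have [l [l0 lcl l1 ly]] := pos G _ perf yD.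
  have [l' [l0' lcl' l1' ly']] := pos G' _ perf' yD'.
  pose ym := \sum_K' l' K' *: rho K' : 'rV[R]_d.
  have -> : y = \sum_K l K *: (rho K - ym).
    apply/matrixP => k i; rewrite ord1 {k} summxE.
    have -> : y 0 i = Num.max (y 0 i) 0 - Num.max (- y 0 i) 0.
      case/orP: (le_total 0 (y 0 i)) => y0.
        by rewrite max_l // max_r ?oppr_le0 // subr0.
      by rewrite max_r // max_l ?oppr_ge0 // opprK add0r.
    rewrite ly ly' -[X in _ - X]mul1r -[X in _ - X * _]l1 mulr_suml -sumrB.
    apply: eq_bigr => K _; rewrite !mxE rhoE mulrBr summxE.
    by congr (_ - _ * _); apply: eq_bigr => K' _; rewrite mxE rhoE.
  apply: convex_sum => // [|K /lcl clK]; first exact: convex_conv_hull.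
  have -> : rho K - ym = \sum_K' l' K' *: (rho K - rho K').
    under eq_bigr do rewrite scalerBr.
    by rewrite sumrB -scaler_suml l1' scale1r.
  apply: convex_sum => // [|K' /lcl' clK']; first exact: convex_conv_hull.
  by apply: sub_conv_hull; exact: rhoT.
apply: conv_hull_sub => [|v /= /mapP[[K K']]].
  apply/convex_setP => u w a b a0 b0 ab Qu Qw x Px; rewrite dotv_lin.
  by have := Qu x Px; have := Qw x Px; nra.
rewrite mem_enum finset.inE => /andP[/= clK clK'] ->.
have sumK (H H' : sgraph 'I_d) (L L' F : {set 'I_d}) :
    clique H L -> F \in stable_sets H ->
    \sum_(i in F) ((i \in L)%:R - (i \in L')%:R) <= 1 :> R.
  move=> clL; rewrite finset.inE => stF; rewrite sumrB !sum_mem_card finset.setIC.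
  have := card_clique_stable clL stF; rewrite -(ler_nat R) => le1.
  by rewrite lerBlDr (le_trans le1) // lerDl.
apply/dual_twinnedP; split=> F FD; under eq_bigr do rewrite !mxE !rhoE ?opprB.
  exact: sumK FD.
exact: sumK FD.
Qed.

Theorem theorem2p8 (R : realType) (d : nat) (D D' : {set {set 'I_d}})
    (hD : simplicial_complex D) (hD' : simplicial_complex D') :
  gorenstein_fano_polytope
    (conv_hull (@complex_polytope R d D `|`
                [set - v | v in @complex_polytope R d D'])) <->
  exists G G' : sgraph 'I_d,
    [/\ perfect G, perfect G', D = stable_sets G & D' = stable_sets G'].
Proof.
rewrite twinned_polytopeE; split=> [[_ dual]|[G [G' [perf perf' DG DG']]]].
  have nneg_le (y : 'rV[R]_d) (F : {set 'I_d}) : (forall i, 0 <= y 0 i) ->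
      \sum_(i in F) - y 0 i <= 1.
    by move=> y0; rewrite sumrN (le_trans _ ler01) // oppr_le0 sumr_ge0.
  have [G [perf DG]] : exists G, perfect G /\ D = stable_sets G.
    apply: (stable_sets_of_bound hD).
    apply: (bound_of_integral_polytope (e := 1) hD _ _ dual).
    - exact: mulr1.
    - exact: rpred1.
    - move=> y /dual_twinnedP[yD _] F FD.
      by under eq_bigr do rewrite mul1r; exact: yD.
    - move=> y y0 yD; rewrite scale1r; apply/dual_twinnedP; split=> // F _.
      exact: nneg_le.
  have [G' [perf' DG']] : exists G, perfect G /\ D' = stable_sets G.
    apply: (stable_sets_of_bound hD').
    apply: (bound_of_integral_polytope (e := -1) hD' _ _ dual).
    - by rewrite mulrNN mulr1.
    - by rewrite rpredN rpred1.
    - move=> y /dual_twinnedP[_ yD] F FD.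
      by under eq_bigr do rewrite mulN1r; exact: yD.
    - move=> y y0 yD; rewrite scaleN1r; apply/dual_twinnedP.
      split=> F FD; under eq_bigr do rewrite mxE ?opprK; last exact: yD.
      exact: nneg_le.
  by exists G, G'.
split; first exact: fano_twinned.
have := @integral_dual_twinned R d G G' perf perf'; rewrite -DG -DG'; exact.
Qed.
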